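(* Let $\mathcal{U}=\{1,\dots,K\}$ index users at positions $\mathbf{u}_k\in\mathbb{R}^{1\times 2}$ and $\mathcal{B}=\{1,\dots,N\}$ index remote radio heads (RRHs) at positions $\mathbf{b}_i\in\mathbb{R}^{1\times 2}$. For a threshold $r$, let $\mathcal{U}_i=\{k\in\mathcal{U}:\|\mathbf{b}_i-\mathbf{u}_k\|_\infty<r\}$ be the set of users served by RRH $i$ and $\mathcal{B}_k=\{i\in\mathcal{B}:\|\mathbf{b}_i-\mathbf{u}_k\|_\infty<r\}$ the set of RRHs serving user $k$. Let $G=\{\mathcal{U},E\}$ be the graph with vertex set $\mathcal{U}$ in which two distinct users $k,m$ are joined by an edge if and only if $\mathcal{B}_k\cap\mathcal{B}_m\neq\emptyset$, i.e. they are served by a common RRH. Then the vertex coloring problem over $G$ $$\min_{c}\ |\mathcal{C}|\quad\text{s.t. } c(k)\neq c(m)\ \text{ if }\ \mathcal{B}_k\cap\mathcal{B}_m\neq\emptyset,\ \ \forall\, k\neq m,\ k,m\in\mathcal{U},$$ where $c:\mathcal{U}\to\mathcal{C}$ maps each user to a color, is equivalent to the training design problem $$\min_{\{\mathbf{x}_k^{\mathrm p}\}}\ \alpha\quad\text{s.t. } \mathbf{x}_k^{\mathrm p}\perp\mathbf{x}_{k'}^{\mathrm p}\ \ \forall\, k\neq k',\ k,k'\in\mathcal{U}_i,\ \forall\, i\in\mathcal{B};\qquad \mathbf{x}_1^{\mathrm p},\dots,\mathbf{x}_K^{\mathrm p}\in\mathbb{C}^{1\times\alpha T}.$$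
   Context: The setting is a cloud radio access network with $K$ users and $N$ RRHs. A transmission frame consists of $T$ channel uses, of which $\alpha T$ (the training length, with time-splitting factor $\alpha\in(0,1)$) are used for training; user $k$ transmits the training sequence $\mathbf{x}_k^{\mathrm p}$, a row vector of length $\alpha T$. The symbol $\mathbf{a}\perp\mathbf{b}$ means that $\mathbf{a}$ is orthogonal to $\mathbf{b}$. The constraint that the sequences of all users served by a common RRH are mutually orthogonal is called local orthogonality. In the equivalence, each color is viewed as an orthogonal training sequence and the number of colors $|\mathcal{C}|$ corresponds to the training length $\alpha T$. The optimal value of the coloring problem is the chromatic number $\chi(G)$, so the minimum training length $\alpha T$ is asserted to be given by $\chi(G)$.
   Formalization: The training sequences are required to be nonzero, and any two users' sequences must be either proportional or orthogonal (each color viewed as an orthogonal sequence); without these constraints the minimum training length can be smaller than the chromatic number. *)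

(* Defs.v *)
From mathcomp Require Export all_boot all_order all_algebra.
From mathcomp Require Export complex.
From mathcomp Require Export all_classical all_reals all_analysis.
Export Order.TTheory GRing.Theory Num.Theory numFieldNormedType.Exports.

#[export] Set Implicit Arguments.
#[export] Unset Strict Implicit.
#[export] Unset Printing Implicit Defensive.

Global Open Scope ring_scope.
Global Open Scope complex_scope.

Definition is_minimum (d : Order.disp_t) (T : porderType d) (A : set T) (m : T) :
  Prop := A m /\ lbound A m.

Section Network.
Variables (R : realType) (K N : nat).
Variables (u : 'I_K -> 'rV[R]_2) (b : 'I_N -> 'rV[R]_2) (r : R).

(* The norm that the library puts on matrices, hence on 'rV[R]_2, is the
   sup norm (mx_norm). *)
Definition users_of (i : 'I_N) : {set 'I_K} := [set k | `|b i - u k| < r].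
Definition rrhs_of (k : 'I_K) : {set 'I_N} := [set i | `|b i - u k| < r].

Definition service_graph : rel 'I_K :=
  fun k m => (k != m) && (rrhs_of k :&: rrhs_of m != finset.set0).

(* [dotmx] is the Hermitian inner product, conjugate-linear on the right. *)
Definition locally_orthogonal (L : nat) (x : 'I_K -> 'rV[R[i]]_L) : Prop :=
  forall (i : 'I_N) (k k' : 'I_K), k != k' ->
    k \in users_of i -> k' \in users_of i -> dotmx (x k) (x k') = 0.

End Network.

Definition proper_coloring (V : finType) (e : rel V) (C : finType) (c : V -> C) :
  Prop := forall k m, e k m -> c k != c m.

Definition coloring_values (V : finType) (e : rel V) : set nat :=
  [set n | exists (C : finType) (c : V -> C), proper_coloring e c /\ #|C| = n].

Definition orthogonal_family (F : numClosedFieldType) (L : nat) (C : finType)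
    (p : C -> 'rV[F]_L) : Prop :=
  (forall a, p a != 0) /\ (forall a a', a != a' -> dotmx (p a) (p a') = 0).

(* A color stands for an orthogonal training sequence, so two users send either
   the same sequence (up to a complex gain, such as a transmit power) or
   orthogonal ones. Without this condition the shortest training length is the
   least dimension of an orthogonal representation of the graph, which can be
   strictly smaller than its chromatic number. *)
Definition orthogonal_reuse (F : numClosedFieldType) (K L : nat)
    (x : 'I_K -> 'rV[F]_L) : Prop :=
  forall k m, (exists a : F, x m = a *: x k) \/ dotmx (x k) (x m) = 0.

(* The zero sequence is orthogonal to everything and carries no training
   signal; allowing it would make the orthogonality constraints void. *)
Definition training_design (R : realType) (K N : nat)
    (u : 'I_K -> 'rV[R]_2) (b : 'I_N -> 'rV[R]_2) (r : R)
    (L : nat) (x : 'I_K -> 'rV[R[i]]_L) : Prop :=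
  [/\ forall k, x k != 0, orthogonal_reuse x & locally_orthogonal u b r x].

Definition training_values (R : realType) (K N : nat)
    (u : 'I_K -> 'rV[R]_2) (b : 'I_N -> 'rV[R]_2) (r : R) (T : nat) : set R :=
  [set alpha | 0 < alpha < 1 /\
     exists (L : nat) (x : 'I_K -> 'rV[R[i]]_L),
       alpha * T%:R = L%:R /\ training_design u b r x].

(* Main.v *)
Require Import Defs.

(** Nonzero sequences that are pairwise proportional or orthogonal fall into
    proportionality classes; the classes are the colors, and one sequence chosen
    in each class gives an orthogonal family, so there are at most [L] classes
    in dimension [L].  Conversely the canonical basis of dimension [n] turns a
    coloring with [n] colors into a design of length [n].  Hence the lengths of
    designs are bounded below by the chromatic number, which is attained. *)

Section OrthogonalReuse.
Variable F : numClosedFieldType.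

Lemma dotmx_eq0 (L : nat) (v : 'rV[F]_L) : (dotmx v v == 0) = (v == 0).
Proof.
apply/eqP/eqP => [v0|->]; last by rewrite dotmxE mul0mx mxE.
by apply: contra_eq v0 => /dotmx_is_dotmx /lt0r_neq0.
Qed.

Lemma dotmxZl (L : nat) (a : F) (v w : 'rV[F]_L) :
  dotmx (a *: v) w = a * dotmx v w.
Proof. by rewrite !dotmxE -scalemxAl mxE. Qed.

(** The matrix [M] whose rows are the sequences has a right inverse [D]: its columns are the
    conjugated sequences divided by their squared norms. So [M] has rank [#|C|], which is at most
    its number [L] of columns. *)
Lemma orthogonal_family_card (L : nat) (C : finType) (p : C -> 'rV[F]_L) :
  orthogonal_family p -> (#|C| <= L)%N.
Proof.
move=> [p0 port].
pose M := \matrix_(i < #|C|) p (enum_val i).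
pose D := \matrix_(l < L, j < #|C|)
  (Num.conj (p (enum_val j) 0 l) / dotmx (p (enum_val j)) (p (enum_val j))).
suff MD : M *m D = 1%:M.
  have /eqP <- : row_free M by apply/row_freeP; exists D.
  exact: rank_leq_col.
apply/matrixP => i j; rewrite !mxE.
transitivity (dotmx (p (enum_val i)) (p (enum_val j)) /
              dotmx (p (enum_val j)) (p (enum_val j))).
  rewrite (dotmxE (p (enum_val i))) mxE mulr_suml; apply: eq_bigr => l _.
  by rewrite !mxE mulrA.
have [<-|ij] := eqVneq i j; first by rewrite divff // dotmx_eq0.
by rewrite port ?mul0r // (inj_eq enum_val_inj).
Qed.

Lemma orthogonal_family_delta (n : nat) :
  orthogonal_family (fun j : 'I_n => delta_mx 0 j : 'rV[F]_n).
Proof.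
split=> [j|j k jk].
  by apply/eqP => /matrixP/(_ 0 j)/eqP; rewrite !mxE !eqxx oner_eq0.
rewrite dotmxE mxE big1 // => l _; rewrite !mxE eqxx /=.
have [->|_] := eqVneq l j; last by rewrite mul0r.
by rewrite (negPf jk) conjC0 mulr0.
Qed.

(** Under [orthogonal_reuse], nonzero sequences that are not orthogonal differ by a nonzero gain.
    Non-orthogonality [e] is therefore an equivalence relation, and its classes serve as colors. *)
Lemma orthogonal_reuse_classes (K L : nat) (x : 'I_K -> 'rV[F]_L) :
  (forall k, x k != 0) -> orthogonal_reuse x ->
  exists (C : finType) (p : C -> 'rV[F]_L) (c : 'I_K -> C) (a : 'I_K -> F),
    [/\ orthogonal_family p,
        forall k m, dotmx (x k) (x m) = 0 -> c k != c m
      & forall k, x k = a k *: p (c k)].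
Proof.
move=> x0 xre; pose e k : pred 'I_K := fun m => dotmx (x k) (x m) != 0.
have ee k : e k k by rewrite /e dotmx_eq0.
have prop k m : e k m -> exists2 a, a != 0 & x m = a *: x k.
  move=> ekm; have [[a xm]|km0] := xre k m; last by rewrite /e km0 eqxx in ekm.
  by exists a => //; apply: contraTneq (x0 m) => a0; rewrite xm a0 scale0r eqxx.
have e_eq k m : e k m -> e k =1 e m.
  move=> /prop[a a0 xm] l.
  by rewrite /e xm dotmxZl mulf_eq0 (negPf a0).
pose rep k := choose (e k) k.
have erep k : e k (rep k) by exact: chooseP.
have rep_eq k m : e k =1 e m -> rep k = rep m.
  (* Once its predicate holds somewhere, [choose] depends neither on the default element nor on how
     the predicate is written, so all users of a class get the same representative. *)
  by move=> km; rewrite /rep (eq_choose km); apply: choose_id; [rewrite -km|]; exact: ee.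
(* Keeping only the image of [rep] leaves one color per class; indexed by all users, the family
   could contain proportional sequences. *)
pose c k : {m | m \in codom rep} := exist _ (rep k) (codom_f rep k).
have scal k : exists a, x k = a *: x (rep k).
  suff /prop[a _ ->] : e (rep k) k by exists a.
  by rewrite -(e_eq _ _ (erep k)).
pose a k := sval (cid (scal k)).
exists {m | m \in codom rep}, (fun m => x (val m)), c, a.
split; last by move=> k; rewrite /a; case: cid.
  split=> [m|k' m']; first exact: x0.
  have [/codomP[k kE] /codomP[m mE]] := (valP k', valP m').
  rewrite -val_eqE kE mE; apply: contra_neq_eq => ekm; apply: rep_eq => l.
  by rewrite (e_eq _ _ (erep k)) (e_eq _ _ (erep m)) (e_eq _ _ ekm).
move=> k m km0; apply/eqP => /(congr1 val) /= km.
have : e k m by rewrite (e_eq _ _ (erep k)) km -(e_eq _ _ (erep m)).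
by rewrite /e km0 eqxx.
Qed.

End OrthogonalReuse.

Lemma coloring_values_minimum (V : finType) (e : rel V) :
  irreflexive e -> exists chi, is_minimum (coloring_values e) chi.
Proof.
move=> e_irr.
have ex : exists n, `[< coloring_values e n >].
  (* Giving every vertex its own color is proper because no vertex is adjacent to itself. *)
  exists #|V|; apply/asboolP; exists V, id; split=> // k m.
  by apply: contraTneq => ->; rewrite e_irr.
have [chi /asboolP chiP chi_min] := ex_minnP ex.
by exists chi; split=> // n /asboolP /chi_min; rewrite leEnat.
Qed.

Section Designs.
Variables (R : realType) (K N : nat).
Variables (u : 'I_K -> 'rV[R]_2) (b : 'I_N -> 'rV[R]_2) (r : R).
Implicit Type L : nat.

Lemma service_graphP k m :
  reflect (k != m /\ exists i, k \in users_of u b r i /\ m \in users_of u b r i)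
          (service_graph u b r k m).
Proof.
rewrite /service_graph; apply: (iffP andP) => -[km kmE]; split=> //.
  case: (elimT (finset.set0Pn _) kmE) => i.
  by rewrite !inE => /andP[ki mi]; exists i; rewrite !inE.
case: kmE => i []; rewrite !inE => ki mi.
by apply: (introT (finset.set0Pn _)); exists i; rewrite !inE ki.
Qed.

Lemma locally_orthogonalP L (x : 'I_K -> 'rV[R[i]]_L) :
  locally_orthogonal u b r x <->
  forall k m, service_graph u b r k m -> dotmx (x k) (x m) = 0.
Proof.
split=> [xo k m /service_graphP[km [i [ki mi]]]|xo i k m km ki mi].
  exact: xo km ki mi.
by apply/xo/service_graphP; split=> //; exists i.
Qed.

(** For the converse direction, a nonzero sequence is not orthogonal to itself, so orthogonal
    sequences carry distinct colors. *)
Lemma coloring_design (C : finType) L (p : C -> 'rV[R[i]]_L) (c : 'I_K -> C) :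
  orthogonal_family p ->
  (proper_coloring (service_graph u b r) c <->
   training_design u b r (fun k => p (c k))).
Proof.
move=> [p0 port]; split=> [cP|[_ _ /locally_orthogonalP po] k m /po].
  split=> [k|k m|]; first exact: p0.
    have [->|/port] := eqVneq (c k) (c m); last by right.
    by left; exists 1; rewrite scale1r.
  by apply/locally_orthogonalP => k m /cP /port.
by apply: contra_eqN => /eqP ->; rewrite dotmx_eq0.
Qed.

Lemma design_coloring L (x : 'I_K -> 'rV[R[i]]_L) :
  training_design u b r x ->
  exists (C : finType) (p : C -> 'rV[R[i]]_L) (c : 'I_K -> C)
         (a : 'I_K -> R[i]),
    [/\ orthogonal_family p, (#|C| <= L)%N,
        proper_coloring (service_graph u b r) c
      & forall k, x k = a k *: p (c k)].
Proof.
move=> [x0 xre /locally_orthogonalP xo].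
have [C [p [c [a [pP cP xE]]]]] := orthogonal_reuse_classes x0 xre.
exists C, p, c, a; split=> //; first exact: orthogonal_family_card pP.
by move=> k m /xo; exact: cP.
Qed.

Lemma coloring_values_design n :
  coloring_values (service_graph u b r) n ->
  exists x : 'I_K -> 'rV[R[i]]_n, training_design u b r x.
Proof.
move=> [C [c [cP <-]]].
exists (fun k => delta_mx 0 (enum_rank (c k))).
apply/(coloring_design _ (orthogonal_family_delta _ #|C|)) => k m /cP.
by rewrite (inj_eq enum_rank_inj).
Qed.

(** The candidate optimum is [chi / T]: having a user makes [chi], hence this ratio, positive, and
    [chi < T] says that it is below 1. *)
Lemma training_values_minimum (T : nat) (alpha : R) : (0 < K)%N ->
  is_minimum (training_values u b r T) alpha <->
  exists chi : nat,
    [/\ is_minimum (coloring_values (service_graph u b r)) chi,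
        (chi < T)%N & alpha * T%:R = chi%:R].
Proof.
move=> K0.
have design_ge chi L (x : 'I_K -> 'rV[R[i]]_L) :
    is_minimum (coloring_values (service_graph u b r)) chi ->
    training_design u b r x -> (chi <= L)%N.
  move=> [_ chi_min] /design_coloring[C [p [c [a [_ CL cP _]]]]].
  apply: leq_trans CL; rewrite -leEnat; apply: chi_min.
  by exists C, c.
have chi_gt0 chi :
    is_minimum (coloring_values (service_graph u b r)) chi -> (0 < chi)%N.
  by move=> [[C [c [_ <-]]] _]; apply/card_gt0P; exists (c (Ordinal K0)).
have chi_training chi :
    is_minimum (coloring_values (service_graph u b r)) chi -> (chi < T)%N ->
    training_values u b r T (chi%:R / T%:R).
  move=> chiP chiT; have chi0 := chi_gt0 _ chiP.
  have T0 : 0 < T%:R :> R by rewrite ltr0n (leq_ltn_trans _ chiT).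
  split.
    rewrite divr_gt0 //=; last by rewrite ltr0n.
    by rewrite ltr_pdivrMr // mul1r ltr_nat.
  have [x xP] := coloring_values_design chiP.1.
  by exists chi, x; split=> //; rewrite divfK // lt0r_neq0.
split=> [[[/andP[a0 a1] [L [x [aT xP]]]] amin]|[chi [chiP chiT aT]]].
  have [|chi chiP] := @coloring_values_minimum _ (service_graph u b r).
    by move=> k; rewrite /service_graph eqxx.
  have chiL := design_ge _ _ _ chiP xP.
  have L0 : (0 < L)%N := leq_trans (chi_gt0 _ chiP) chiL.
  (* Both [alpha] and [L = alpha * T] are positive, which excludes [T = 0]. *)
  have T0 : 0 < T%:R :> R.
    by move: L0; rewrite -(ltr0n R) -aT pmulr_rgt0.
  have LT : (L < T)%N by rewrite -(ltr_nat R) -aT gtr_pMl.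
  have chiT := leq_ltn_trans chiL LT.
  exists chi; split=> //; rewrite aT; congr _%:R.
  (* It remains to see [L <= chi], which is the minimality of [alpha] against the admissible value
     [chi / T]. *)
  apply/eqP; rewrite eqn_leq chiL andbT -(ler_nat R) -aT -ler_pdivlMr //.
  exact/amin/chi_training.
have T0 : 0 < T%:R :> R by rewrite ltr0n (leq_ltn_trans _ chiT).
have -> : alpha = chi%:R / T%:R by rewrite -aT mulfK // lt0r_neq0.
split=> [|beta [_ [L [x [bT xP]]]]]; first exact: chi_training.
by rewrite ler_pdivrMr // bT ler_nat (design_ge _ _ _ chiP xP).
Qed.

End Designs.

Theorem theorem1 (R : realType) (K N T : nat) (hK : (0 < K)%N)
    (u : 'I_K -> 'rV[R]_2) (b : 'I_N -> 'rV[R]_2) (r : R) :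
  [/\ (* reading colors as orthogonal sequences turns colorings into designs *)
      forall (C : finType) (L : nat) (p : C -> 'rV[R[i]]_L) (c : 'I_K -> C),
        orthogonal_family p ->
        (proper_coloring (service_graph u b r) c <->
         training_design u b r (fun k => p (c k))),
      (* every design of length L arises so, with at most L colors *)
      forall (L : nat) (x : 'I_K -> 'rV[R[i]]_L),
        training_design u b r x ->
        exists (C : finType) (p : C -> 'rV[R[i]]_L) (c : 'I_K -> C)
               (a : 'I_K -> R[i]),
          [/\ orthogonal_family p, (#|C| <= L)%N,
              proper_coloring (service_graph u b r) c
            & forall k, x k = a k *: p (c k)],
      (* the coloring problem has an optimal value, the chromatic number *)
      exists chi : nat,
        is_minimum (coloring_values (service_graph u b r)) chi
    & (* and the optimal training length alpha * T is that number *)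
      forall alpha : R,
        is_minimum (training_values u b r T) alpha <->
        exists chi : nat,
          [/\ is_minimum (coloring_values (service_graph u b r)) chi,
              (chi < T)%N & alpha * T%:R = chi%:R]].
Proof.
split.
- exact: coloring_design.
- exact: design_coloring.
- by apply: coloring_values_minimum => k; rewrite /service_graph eqxx.
- by move=> alpha; exact: training_values_minimum.
Qed.
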